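(* For every integer $k\ge2$ there exist a constant $C_k>0$ and a lower bound $D_k>1$, both depending only on $k$, such that the following holds for all $D\ge D_k$. Let $(\mathscr V,\mathbf c,\boldsymbol\mu)$ be an entropy system in $\mathbb Q^k$, where $\mathbf c=(c_1,\ldots,c_{r+1})$, and put $c=c_{r+1}$. Suppose that $B\subseteq(D^c,D]\cap\mathbb Z$ satisfies $$\left|\#\bigl(B\cap(D^\alpha,D^\beta]\bigr)-(\beta-\alpha)\log D\right|\le2(\log D)^{3/4}\qquad(c\le\alpha\le\beta\le1).$$ Then $$\#\mathscr L_{\mathscr V,\mathbf c,\boldsymbol\mu}(B)\le\exp\bigl(C_k(\log D)^{3/4}\bigr)\,D^{\min_{\mathscr V'\le\mathscr V}\mathrm e(\mathscr V',\mathbf c,\boldsymbol\mu)}.$$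
   Context: Vector spaces are over $\mathbb Q$; $\mathbf 1=(1,\dots,1)\in\mathbb Q^k$; $\{0,1\}^k\subset\mathbb Q^k$; logarithms are natural and $0\log0=0$. $U\le V$ means $U$ is a subspace of $V$, and $U<V$ a proper subspace. For a finite set $B$ of integers, $\Sigma(B)=\sum_{b\in B}b$, $\Sigma(\varnothing)=0$. An entropy system is a triple $(\mathscr V,\mathbf c,\boldsymbol\mu)$ with $\mathscr V=(V_0,\dots,V_r)$, $\mathbf c=(c_1,\dots,c_{r+1})$, $\boldsymbol\mu=(\mu_1,\dots,\mu_r)$ such that: (a) $\langle\mathbf 1\rangle=V_0<V_1<\cdots<V_r\le\mathbb Q^k$ and each $V_j$ is spanned by points of $\{0,1\}^k$; (b) $V_r$ is non-degenerate: for all $1\le s<t\le k$ there is $x\in V_r$ with $x_s\ne x_t$; (c) $1\ge c_1\ge c_2\ge\cdots\ge c_{r+1}\ge0$; (d) each $\mu_j$ is a probability measure on $V_j\cap\{0,1\}^k$ (extended by zero). For a finitely supported probability measure $\mu$ on $\mathbb Q^k$ and $W\le\mathbb Q^k$, put $\mu(W+x)=\sum_{y\in W+x}\mu(y)$ and $\mathbb H_\mu(W)=-\sum_x\mu(x)\log\mu(W+x)$. A subflag $\mathscr V'\le\mathscr V$ is a sequence $\langle\mathbf 1\rangle=V_0'\le V_1'\le\cdots\le V_r'$ of subspaces with $V_j'\le V_j$ for all $j$, and $$\mathrm e(\mathscr V',\mathbf c,\boldsymbol\mu)=\sum_{j=1}^r(c_j-c_{j+1})\mathbb H_{\mu_j}(V_j')+\sum_{j=1}^rc_j\dim(V_j'/V_{j-1}').$$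 Given $D>1$ and $B\subseteq(D^c,D]\cap\mathbb Z$ with $c=c_{r+1}$, put $N_j=\#\bigl(B\cap(D^{c_{j+1}},D^{c_j}]\bigr)$ for $1\le j\le r$. Then $\mathscr L_{\mathscr V,\mathbf c,\boldsymbol\mu}(B)$ is the set of classes $$\Bigl(\sum_{\omega\in\{0,1\}^k}\omega\,\Sigma(B_\omega)\Bigr)+\langle\mathbf 1\rangle\in\mathbb Q^k/\langle\mathbf 1\rangle,$$ where $(B_\omega)_{\omega\in\{0,1\}^k}$ ranges over the partitions of $B$ (empty parts allowed) satisfying $$\#\bigl(B_\omega\cap(D^{c_{j+1}},D^{c_j}]\bigr)=\mu_j(\omega)N_j\quad(1\le j\le r,\ \omega\in\{0,1\}^k),\qquad B_\omega\cap(D^{c_1},D]=\varnothing\quad(\omega\notin V_0).$$ *)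

(* Defs.v *)
From HB Require Import structures.
From mathcomp Require Import all_boot all_order all_algebra.
From mathcomp Require Import finmap.
From mathcomp Require Import all_classical all_reals all_analysis.

Set Implicit Arguments.
Unset Strict Implicit.
Unset Printing Implicit Defensive.

Import Order.TTheory GRing.Theory Num.Theory.
Local Open Scope ring_scope.

(* The index type 'rV[bool]_k is the cube {0,1}^k; [cube_pt w] is the point w
   seen in Q^k. *)
Definition cube_pt (k : nat) (w : 'rV[bool]_k) : 'rV[rat]_k :=
  map_mx (fun b : bool => b%:R) w.

Definition line1 (k : nat) : {vspace 'rV[rat]_k} :=
  <[const_mx 1 : 'rV[rat]_k]>%VS.

Definition spanned_by_cube (k : nat) (U : {vspace 'rV[rat]_k}) : Prop :=
  exists S : seq 'rV[bool]_k, U = <<map (@cube_pt k) S>>%VS.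

Definition nondegenerate (k : nat) (U : {vspace 'rV[rat]_k}) : Prop :=
  forall s t : 'I_k, (s < t)%N -> exists2 x, x \in U & x 0 s != x 0 t.

Definition is_prob_on (R : realType) (k : nat) (U : {vspace 'rV[rat]_k})
    (mu : 'rV[bool]_k -> R) : Prop :=
  [/\ forall w, 0 <= mu w,
      forall w, cube_pt w \notin U -> mu w = 0
    & \sum_w mu w = 1].

(* Families are indexed by nat with the mathematical (1-based where relevant)
   indices: only V 0, ..., V r, c 1, ..., c r.+1 and mu 1, ..., mu r matter. *)
Definition entropy_system (R : realType) (k r : nat)
    (V : nat -> {vspace 'rV[rat]_k}) (c : nat -> R)
    (mu : nat -> 'rV[bool]_k -> R) : Prop :=
  [/\ [/\ V 0%N = line1 k,
          forall j, (j < r)%N -> (V j <= V j.+1)%VS /\ V j != V j.+1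
        & forall j, (j <= r)%N -> spanned_by_cube (V j)],
      nondegenerate (V r),
      [/\ c 1%N <= 1,
          forall j, (1 <= j <= r)%N -> c j.+1 <= c j
        & 0 <= c r.+1]
    & forall j, (1 <= j <= r)%N -> is_prob_on (V j) (mu j)].

Definition coset_mass (R : realType) (k : nat) (mu : 'rV[bool]_k -> R)
    (W : {vspace 'rV[rat]_k}) (x : 'rV[rat]_k) : R :=
  \sum_(w : 'rV[bool]_k | cube_pt w - x \in W) mu w.

(* Here [ln 0 = 0] in the library, and terms with mu w = 0 vanish anyway. *)
Definition entropy (R : realType) (k : nat) (mu : 'rV[bool]_k -> R)
    (W : {vspace 'rV[rat]_k}) : R :=
  - \sum_w mu w * ln (coset_mass mu W (cube_pt w)).

Definition subflag (k r : nat) (V' V : nat -> {vspace 'rV[rat]_k}) : Prop :=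
  [/\ V' 0%N = line1 k,
      forall j, (j < r)%N -> (V' j <= V' j.+1)%VS
    & forall j, (j <= r)%N -> (V' j <= V j)%VS].

(* [dim (V'_j / V'_{j-1})] is the difference of dimensions, since
   V'_{j-1} <= V'_j in a subflag. *)
Definition flag_e (R : realType) (k r : nat) (V' : nat -> {vspace 'rV[rat]_k})
    (c : nat -> R) (mu : nat -> 'rV[bool]_k -> R) : R :=
  \sum_(1 <= j < r.+1) (c j - c j.+1) * entropy (mu j) (V' j) +
  \sum_(1 <= j < r.+1) c j * ((\dim (V' j))%:R - (\dim (V' j.-1))%:R).

Definition subflag_values (R : realType) (k r : nat)
    (V : nat -> {vspace 'rV[rat]_k}) (c : nat -> R)
    (mu : nat -> 'rV[bool]_k -> R) : set R :=
  [set e | exists2 V', subflag r V' V & e = flag_e r V' c mu]%classic.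

Definition is_min (R : realType) (A : set R) (m : R) : Prop :=
  A m /\ lbound A m.

Definition between (R : realType) (B : {fset int}) (a b : R) : {fset int} :=
  [fset n in B | a < n%:~R <= b]%fset.

Definition fset_sum (B : {fset int}) : int := \sum_(b <- B) b.

Definition is_partition_of (k : nat) (B : {fset int})
    (P : 'rV[bool]_k -> {fset int}) : Prop :=
  (forall w w', w != w' -> [disjoint P w & P w']%fset) /\
  (forall b, b \in B <-> exists w, b \in P w).

Definition admissible (R : realType) (k r : nat)
    (V : nat -> {vspace 'rV[rat]_k}) (c : nat -> R)
    (mu : nat -> 'rV[bool]_k -> R) (D : R) (B : {fset int})
    (P : 'rV[bool]_k -> {fset int}) : Prop :=
  [/\ is_partition_of B P,
      forall j w, (1 <= j <= r)%N ->
        #|` between (P w) (D `^ c j.+1) (D `^ c j)|%:R =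
        mu j w * #|` between B (D `^ c j.+1) (D `^ c j)|%:R
    & forall w, cube_pt w \notin V 0%N ->
        between (P w) (D `^ c 1%N) D = fset0].

Definition partition_vector (k : nat) (P : 'rV[bool]_k -> {fset int}) :
    'rV[rat]_k :=
  \sum_w (fset_sum (P w))%:~R *: cube_pt w.

(* The class of x in the quotient by W, as a subset of Q^k. *)
Definition vclass (k : nat) (W : {vspace 'rV[rat]_k}) (x : 'rV[rat]_k) :
    set 'rV[rat]_k :=
  [set y | y - x \in W]%classic.

Definition Lset (R : realType) (k r : nat)
    (V : nat -> {vspace 'rV[rat]_k}) (c : nat -> R)
    (mu : nat -> 'rV[bool]_k -> R) (D : R) (B : {fset int}) :
    set (set 'rV[rat]_k) :=
  [set vclass (line1 k) (partition_vector P) | P in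
    [set P | admissible r V c mu D B P]]%classic.

(* Main.v *)
Require Import Defs.
From HB Require Import structures.
From mathcomp Require Import all_boot all_order all_algebra.
From mathcomp Require Import finmap.
From mathcomp Require Import all_classical all_reals all_analysis.
From mathcomp Require Import ring lra zify.

Set Implicit Arguments.
Unset Strict Implicit.
Unset Printing Implicit Defensive.

Import Order.TTheory GRing.Theory Num.Theory.
Local Open Scope ring_scope.

(** Only an upper bound is needed, so it suffices to treat one flag W at which
    the minimum of e is attained, and W can be chosen well.  Replacing each
    member of a subflag by the span of the differences of cube points that it
    contains leaves all the entropies unchanged and only lowers dimensions;
    since the coefficients c_j decrease, e does not increase
    ([flag_e_diff_core]).  There are finitely many flags of this kind, so the
    minimum exists and is attained at one of them ([flag_min_attained]).

    Write L = ln D.  Give b in B the level j if it lies in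
    (D^(c_(j+1)), D^(c_j)], and level 0 if it exceeds D^(c_1).  A partition is a
    colouring om of B by cube points, and its vector is the sum of the b om(b).
    Let f(b) be a fixed representative of the coset of om(b) modulo W_j, with j
    the level of b.  The vector is determined modulo <1> by f together with the
    sum u of the b (om(b) - f(b)) modulo <1>.

    The number of possible f is at most exp (sum_j N_j H_(mu_j) (W_j)): choosing
    the values f(b) independently with the pushed-forward measures defines a
    probability on all colourings, and each f in question has probability equal
    to the inverse of this bound ([card_typical_reductions]).

    To count the u, take a basis adapted to W and made of differences of cube
    points ([adapted_basis]).  Multiplying by the adjugate of its matrix turns
    coordinates into integers at bounded cost ([adapted_coordinates],
    [coord_le]).  A coordinate that belongs to W_j but not to W_(j-1) only
    receives contributions from the b of level at least j, which are at most
    D^(c_j); so it takes O(L D^(c_j)) values ([coord_le_box]), while the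
    coordinates in W_0 = <1> are irrelevant.  Over all coordinates this gives
    O(L)^k times D to the power sum_j c_j dim (W_j / W_(j-1)).

    The basis is taken from a finite set depending only on k, so all constants
    depend only on k.  The two counts multiply to D^e(W) up to the error terms
    in N_j and a power of L, both absorbed by exp (O(L^(3/4))). *)

(** * Bases adapted to a flag *)

Section AdaptedBasis.
Variables (F : fieldType) (vT : vectType F) (I : Type) (d : I -> vT).

Lemma free_extension (S X : seq I) : free (map d X) ->
  exists Y, free (map d (X ++ Y)) /\
    (<<map d (X ++ Y)>> = <<map d X>> + <<map d S>>)%VS.
Proof.
elim: S X => [|s S IH] X fX.
  by exists [::]; rewrite cats0 span_nil addv0.
have [sX|sX] := boolP (d s \in <<map d X>>%VS).
  have [Y [fY sY]] := IH X fX.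
  exists Y; split => //; rewrite sY /= span_cons addvA; congr (_ + _)%VS.
  by apply/esym/addv_idPl; rewrite -memvE.
have fXs : free (map d (rcons X s)).
  rewrite map_rcons -cats1 (perm_free (permEl (perm_catC _ _))) /= free_cons.
  by rewrite sX fX.
have [Y [fY sY]] := IH _ fXs.
exists (s :: Y); rewrite -cat_rcons; split => //.
by rewrite sY map_rcons -cats1 span_cat span_seq1 /= span_cons addvA.
Qed.

Lemma flag_subv (W : nat -> {vspace vT}) n j :
  (forall j, (j < n)%N -> (W j <= W j.+1)%VS) -> (j <= n)%N -> (W j <= W n)%VS.
Proof.
elim: n => [|n IH] Wmon; first by rewrite leqn0 => /eqP ->.
rewrite leq_eqVlt => /predU1P[->//|jn].
apply: (subv_trans (IH _ jn)); last by apply: Wmon.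
by move=> i ni; apply: Wmon; apply: ltnW.
Qed.

(** The basis is built upwards along the flag, so that each W_j is spanned by
    an initial segment; taking the vectors from the family [d] rather than
    arbitrarily keeps them in a finite set known in advance. *)
Lemma adapted_basis (W : nat -> {vspace vT}) n :
  (forall j, (j < n)%N -> (W j <= W j.+1)%VS) ->
  (forall j, (j <= n)%N -> exists S, W j = <<map d S>>%VS) ->
  exists X, [/\ free (map d X), <<map d X>>%VS = W n
    & forall j, (j <= n)%N -> W j = <<take (\dim (W j)) (map d X)>>%VS].
Proof.
elim: n => [|n IH] Wmon Wgen.
  have [S WS] := Wgen 0%N (leqnn _).
  have [|Y [fY sY]] := @free_extension S [::]; first by rewrite nil_free.
  rewrite /= span_nil add0v -WS in sY.
  exists Y; split => // j; rewrite leqn0 => /eqP ->.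
  by rewrite -sY (eqP fY) take_size.
have [j jn|j jn|X [fX sX tX]] := IH.
- by apply: Wmon; apply: ltnW.
- by apply: Wgen; apply: leqW.
have [S WS] := Wgen n.+1 (leqnn _).
have [Y [fY sY]] := free_extension S fX.
have sY' : <<map d (X ++ Y)>>%VS = W n.+1.
  by rewrite sY sX -WS; apply/addv_idPr/Wmon.
exists (X ++ Y); split => // j; rewrite leq_eqVlt => /predU1P[->|jn].
  by rewrite -sY' (eqP fY) take_size.
rewrite [LHS]tX // map_cat takel_cat //.
rewrite -(eqP fX) sX; apply/dimvS/flag_subv => // i ni.
by apply: Wmon; apply: ltnW.
Qed.
End AdaptedBasis.

Definition cube_int (k : nat) (w : 'rV[bool]_k) : 'rV[int]_k :=
  map_mx (fun b : bool => b%:R) w.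

Definition cube_diff (k : nat) (p : 'rV[bool]_k * 'rV[bool]_k) : 'rV[rat]_k :=
  cube_pt p.1 - cube_pt p.2.

(** The rows are indexed by pairs of cube points, and not given as an arbitrary
    integer matrix, so that there are only finitely many matrices of this form
    for each k. *)
Definition diff_mx (k : nat) (g : {ffun 'I_k -> 'rV[bool]_k * 'rV[bool]_k}) :
    'M[int]_k :=
  \matrix_(i, j) (cube_int (g i).1 - cube_int (g i).2) 0 j.

Lemma dimv_row_le k (U : {vspace 'rV[rat]_k}) : (\dim U <= k)%N.
Proof. by have := dimvS (subvf U); rewrite dimvf /dim /= mul1n. Qed.

Lemma map_cube_int k (w : 'rV[bool]_k) : map_mx intr (cube_int w) = cube_pt w.
Proof. by apply/rowP => i; rewrite !mxE; case: (w 0 i). Qed.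

Lemma map_diff_mx k (g : {ffun 'I_k -> 'rV[bool]_k * 'rV[bool]_k}) i :
  row i (map_mx intr (diff_mx g)) = cube_diff (g i).
Proof.
by apply/rowP => j; rewrite /cube_diff -!map_cube_int !mxE rmorphB.
Qed.

Lemma cube_diff_span k :
  (<<map (@cube_diff k) (enum [set: 'rV[bool]_k * 'rV[bool]_k])>> = fullv)%VS.
Proof.
apply/eqP; rewrite eqEsubv subvf /=; apply/subvP => x _.
rewrite (row_sum_delta x); apply: memv_suml => i _; apply: memvZ.
apply: memv_span.
apply/mapP; exists (\row_j (j == i), \row_j false); first by rewrite mem_enum inE.
apply/rowP => j; rewrite !mxE eqxx /= subr0.
by rewrite eq_sym.
Qed.

(** With M the matrix of an adapted basis, x *m \adj M is \det M times the
    coordinate vector of x.  The adjugate is used in place of the inverse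
    because it keeps the coordinates of integer vectors integral. *)
Lemma adapted_coordinates k (W : nat -> {vspace 'rV[rat]_k}) n :
  (forall j, (j < n)%N -> (W j <= W j.+1)%VS) ->
  (forall j, (j <= n)%N -> exists S, W j = <<map (@cube_diff k) S>>%VS) ->
  exists g, forall j x, (j <= n)%N ->
    (map_mx intr x \in W j) =
    [forall i : 'I_k, (\dim (W j) <= i)%N ==> ((x *m \adj (diff_mx g)) 0 i == 0)].
Proof.
move=> Wmon Wgen.
(* Adding the whole space as a last member makes the basis one of Q^k. *)
pose W' j := if (j <= n)%N then W j else fullv.
have [j jn|j jn|X [fX sX tX]] := @adapted_basis _ _ _ (@cube_diff k) W' n.+1.
- rewrite /W' -[X in (X <= _)%VS]/(if (j < n.+1)%N then _ else _) jn.
  by case: ifP => [/Wmon//|_]; rewrite subvf.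
- rewrite /W'; case: ifP => [/Wgen//|_].
  by exists (enum [set: 'rV[bool]_k * 'rV[bool]_k]); rewrite cube_diff_span.
have sizeX : size X = k.
  move: (eqP fX); rewrite sX /W' ltnn dimvf size_map.
  by move=> <-; rewrite /dim /= mul1n.
pose g := [ffun i : 'I_k => nth (0, 0) X i]; exists g => j x jn.
set M := diff_mx g; pose Mq := map_mx (intr : int -> rat) M.
have rowM i : row i Mq = (map (@cube_diff k) X)`_i.
  by rewrite map_diff_mx ffunE (nth_map (0, 0)) // sizeX.
have mulM (v : 'rV_k) : v *m Mq = \sum_i v 0 i *: (map (@cube_diff k) X)`_i.
  by rewrite mulmx_sum_row; apply: eq_bigr => i _; rewrite rowM.
have detM : \det Mq != 0.
  rewrite -unitfE -unitmxE -row_free_unit; apply: inj_row_free => v.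
  rewrite mulM => v0; apply/rowP => i; rewrite mxE.
  have sXk : size (map (@cube_diff k) X) == k by rewrite size_map sizeX.
  have := (@freeP _ _ _ (Tuple sXk) fX) (v 0) v0.
  exact.
have Wj : W j = <<take (\dim (W j)) (map (@cube_diff k) X)>>%VS.
  by have := tX j (leqW jn); rewrite /W' jn.
have adjq : map_mx intr (x *m \adj M) = map_mx intr x *m \adj Mq :> 'rV[rat]_k.
  by rewrite map_mxM map_mx_adj.
have coord0 i : ((x *m \adj M) 0 i == 0) = ((map_mx intr x *m \adj Mq) 0 i == 0).
  by rewrite -adjq [in RHS]mxE intr_eq0.
have dk := dimv_row_le (W j).
apply/idP/forallP => [xW i|x0].
  apply/implyP => di; rewrite coord0.
  set Z := take _ _ in Wj.
  have sZ : size Z = \dim (W j).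
    by rewrite size_take size_map sizeX; case: ltngtP dk => // ->.
  rewrite Wj in xW; have := coord_span (X := in_tuple Z) xW.
  rewrite /= => ->.
  rewrite mulmx_suml summxE big1 // => l _; rewrite -scalemxAl mxE.
  have lk : (l < k)%N by rewrite (leq_trans (ltn_ord l)) // /= sZ.
  rewrite (_ : _`_l = row (Ordinal lk) Mq); last first.
    by rewrite rowM /= nth_take // -sZ.
  rewrite -row_mul mul_mx_adj !mxE.
  rewrite (_ : (Ordinal lk == i) = false) ?mulr0n ?mulr0 //.
  apply/negP => /eqP li; move: di; rewrite -li /= leqNgt -sZ.
  by rewrite ltn_ord.
have -> : map_mx intr x = (\det Mq)^-1 *: ((map_mx intr x *m \adj Mq) *m Mq).
  by rewrite -mulmxA mul_adj_mx mul_mx_scalar scalerA mulVf // scale1r.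
apply: memvZ; rewrite mulM; apply: memv_suml => i _.
have [di|id] := leqP (\dim (W j)) i.
  by move: (x0 i); rewrite di /= coord0 => /eqP ->; rewrite scale0r mem0v.
apply: memvZ; rewrite Wj; apply: memv_span.
rewrite -(nth_take 0 id) mem_nth // size_take size_map sizeX.
by case: ifP.
Qed.

(** * Colourings modulo the flag *)

(** The weights of all the functions T -> Q add up to 1, by distributivity. *)
Lemma card_mul_weight_le1 (R : realType) (T Q : finType) (p : T -> Q -> R)
    (A : {set {ffun T -> Q}}) (delta : R) :
  (forall b q, 0 <= p b q) -> (forall b, \sum_q p b q = 1) ->
  (forall f, f \in A -> delta <= \prod_b p b (f b)) ->
  #|A|%:R * delta <= 1.
Proof.
move=> p0 p1 pA.
have tot : \sum_(f : {ffun T -> Q}) \prod_b p b (f b) = 1.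
  by rewrite -bigA_distr_bigA /= big1.
rewrite -[leRHS]tot (bigID (mem A)) /= -[leLHS]addr0 lerD //; last first.
  by apply: sumr_ge0 => f _; apply: prodr_ge0.
by rewrite mulr_natl -sumr_const; apply: ler_sum.
Qed.

Definition coset_rep (k : nat) (W : {vspace 'rV[rat]_k}) (w : 'rV[bool]_k) :
    'rV[bool]_k :=
  odflt 0 [pick w' | cube_pt w' - cube_pt w \in W].

Lemma coset_rep_diff k (W : {vspace 'rV[rat]_k}) w :
  cube_pt (coset_rep W w) - cube_pt w \in W.
Proof.
rewrite /coset_rep; case: pickP => //= /(_ w).
by rewrite subrr mem0v.
Qed.

Lemma eq_coset_rep k (W : {vspace 'rV[rat]_k}) w w' :
  (coset_rep W w == coset_rep W w') = (cube_pt w - cube_pt w' \in W).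
Proof.
apply/eqP/idP => [e|ww'].
  have h := rpredB (coset_rep_diff W w') (coset_rep_diff W w).
  by move: h; rewrite e opprB addrC addrA subrK.
rewrite /coset_rep; congr odflt; apply: eq_pick => v.
by rewrite -[LHS](rpredDr _ ww') addrA subrK.
Qed.

Section Entropy.
Variables (R : realType) (k : nat) (U W : {vspace 'rV[rat]_k}).
Variable mu : 'rV[bool]_k -> R.
Hypothesis mu_prob : is_prob_on U mu.

Let mu_ge0 w : 0 <= mu w. Proof. by case: mu_prob. Qed.
Let mu_sum : \sum_w mu w = 1. Proof. by case: mu_prob. Qed.

Lemma coset_mass_ge w : mu w <= coset_mass mu W (cube_pt w).
Proof.
rewrite /coset_mass (bigD1 w) /= ?subrr ?mem0v // lerDl.
exact: sumr_ge0.
Qed.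

Lemma coset_mass_le1 x : coset_mass mu W x <= 1.
Proof.
rewrite -mu_sum /coset_mass [leRHS](bigID (fun w => cube_pt w - x \in W)) /=.
by rewrite lerDl sumr_ge0.
Qed.

Lemma entropy_ge0 : 0 <= entropy mu W.
Proof.
rewrite /entropy -sumrN sumr_ge0 // => w _; rewrite -mulrN mulr_ge0 //.
by rewrite oppr_ge0; apply: ln_le0; apply: coset_mass_le1.
Qed.

(** Each of the 2^k terms is at most 1, since mu(w) <= mu(W + w) and
    ln (1 / p) <= 1 / p. *)
Lemma entropy_le_card : entropy mu W <= #|{: 'rV[bool]_k}|%:R.
Proof.
rewrite /entropy -sumrN -sum1_card natr_sum ler_sum // => w _.
have [->|mw] := eqVneq (mu w) 0; first by rewrite mul0r oppr0.
have m0 : 0 < mu w by rewrite lt_def mw mu_ge0.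
have p0 := lt_le_trans m0 (coset_mass_ge w).
rewrite -mulrN -lnV ?posrE //.
apply: (@le_trans _ _ (mu w * (coset_mass mu W (cube_pt w))^-1)).
  by rewrite ler_wpM2l // ltW // ln_sublinear // invr_gt0.
by rewrite ler_pdivrMr // mul1r coset_mass_ge.
Qed.

(** The image of mu in the quotient by W, carried by the coset
    representatives. *)
Definition rep_mass (q : 'rV[bool]_k) : R :=
  \sum_(w | coset_rep W w == q) mu w.

Lemma rep_mass_ge0 q : 0 <= rep_mass q.
Proof. exact: sumr_ge0. Qed.

Lemma sum_rep_mass : \sum_q rep_mass q = 1.
Proof. by rewrite -mu_sum [RHS](partition_big (coset_rep W) predT). Qed.

Lemma rep_massE w : rep_mass (coset_rep W w) = coset_mass mu W (cube_pt w).
Proof. by apply: eq_bigl => w'; rewrite eq_coset_rep. Qed.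
End Entropy.

Section Colourings.
Variables (R : realType) (k r : nat) (T : finType) (lvl : T -> 'I_r.+1).
Variables (U W : nat -> {vspace 'rV[rat]_k}) (mu : nat -> 'rV[bool]_k -> R).
Hypothesis mu_prob : forall j, (1 <= j <= r)%N -> is_prob_on (U j) (mu j).

(** The form taken by admissible partitions once B is replaced by an abstract
    finite type in which every element has a level. *)
Definition typical (om : T -> 'rV[bool]_k) : Prop :=
  (forall b, lvl b = 0%N :> nat -> cube_pt (om b) \in W 0%N) /\
  (forall j w, (1 <= j <= r)%N ->
    #|[set b | (lvl b == j :> nat) && (om b == w)]|%:R =
    mu j w * #|[set b | lvl b == j :> nat]|%:R).

(** The product weights of [card_mul_weight_le1] are the pushed-forward measures
    at the levels j >= 1, and a point mass at level 0, where the reduction is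
    constant.  Because om has exactly mu_j(w) N_j elements of level j and colour
    w, the logarithm of the weight of its reduction is
    sum_j N_j sum_w mu_j(w) ln mu_j(W_j + w), that is - sum_j N_j H_(mu_j)(W_j). *)
Lemma card_typical_reductions (A : {set {ffun T -> 'rV[bool]_k}}) :
  (forall f, f \in A -> exists2 om, typical om &
     forall b, f b = coset_rep (W (lvl b)) (om b)) ->
  #|A|%:R <= expR (\sum_(1 <= j < r.+1)
     #|[set b | lvl b == j :> nat]|%:R * entropy (mu j) (W j)).
Proof.
move=> hA; set E := (X in expR X).
pose p b q : R := if (lvl b == 0 :> nat)%N then (q == coset_rep (W 0%N) 0)%:R
  else rep_mass (W (lvl b)) (mu (lvl b)) q.
have lvlP b : (lvl b == 0 :> nat)%N = false -> (1 <= lvl b <= r)%N.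
  by move=> lb; rewrite lt0n lb -ltnS ltn_ord.
suff : #|A|%:R * expR (- E) <= 1 by rewrite expRN ler_pdivrMr ?expR_gt0 // mul1r.
apply: (@card_mul_weight_le1 _ _ _ p) => [b q|b|f /hA[om [om0 omT] fE]].
- rewrite /p; case: ifP => [_|/lvlP lb]; first by [].
  exact: rep_mass_ge0 (mu_prob lb) _.
- rewrite /p; have [lb|/negbTE lb] := boolP (lvl b == 0 :> nat)%N; last first.
    exact: sum_rep_mass (mu_prob (lvlP _ lb)).
  rewrite (bigD1 (coset_rep (W 0%N) 0)) //= eqxx big1 ?addr0 // => q.
  by move=> /negbTE ->.
have p0 b : (lvl b == 0 :> nat)%N -> p b (f b) = 1.
  move=> lb; rewrite /p lb fE (eqP lb) eq_coset_rep.
  rewrite (_ : cube_pt 0 = 0) ?subr0 ?om0 //; first by apply/eqP.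
  by apply/rowP => i; rewrite !mxE.
have pE b : (lvl b == 0 :> nat)%N = false ->
    p b (f b) = coset_mass (mu (lvl b)) (W (lvl b)) (cube_pt (om b)).
  by move=> lb; rewrite /p lb fE rep_massE.
have ppos b : 0 < p b (f b).
  have [lb|/negbTE lb] := boolP (lvl b == 0 :> nat)%N; first by rewrite p0.
  rewrite pE //; have lr := lvlP _ lb.
  apply: lt_le_trans (coset_mass_ge _ (mu_prob lr) _).
  have [mu0 _ _] := mu_prob lr; rewrite lt_def mu0 andbT.
  (* The colour om b is used at the level of b, so its measure is not 0. *)
  apply/eqP => m0; have := omT _ (om b) lr; rewrite m0 mul0r.
  move=> /eqP; rewrite pnatr_eq0 cards_eq0 => /eqP/setP/(_ b).
  by rewrite !inE !eqxx.
have -> : \prod_b p b (f b) = expR (\sum_b ln (p b (f b))).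
  by rewrite expR_sum; apply: eq_bigr => b _; rewrite lnK ?posrE.
rewrite ler_expR le_eqVlt; apply/orP; left; apply/eqP.
rewrite [RHS](partition_big lvl predT) //= big_ord_recl /=.
rewrite big1 ?add0r => [|b /eqP lb]; last by rewrite p0 ?ln1 // lb.
rewrite /E big_add1 /= big_mkord -sumrN; apply: eq_bigr => j _.
rewrite /entropy mulrN opprK mulr_sumr.
have lj : (1 <= j.+1 <= r)%N by rewrite /= ltn_ord.
transitivity (\sum_(w : 'rV[bool]_k) \sum_(b | (lvl b == j.+1 :> nat) && (om b == w))
   ln (coset_mass (mu j.+1) (W j.+1) (cube_pt w))).
  apply: eq_bigr => w _; rewrite mulrA [_ * mu _ _]mulrC -omT //.
  by rewrite sumr_const mulr_natl; congr (_ *+ _); apply: eq_card => b; rewrite !inE.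
rewrite [RHS](partition_big om predT) //=; apply: eq_bigr => w _.
apply: eq_big => [b|b /andP[/eqP lb /eqP <-]].
  by rewrite -(inj_eq val_inj) /=.
by rewrite pE ?lb.
Qed.
End Colourings.

(** * Attaining the minimum over subflags *)

Lemma antitone_coeffs (R : realType) (r : nat) (c : nat -> R) i j :
  (forall j, (1 <= j <= r)%N -> c j.+1 <= c j) ->
  (1 <= i)%N -> (i <= j)%N -> (j <= r.+1)%N -> c j <= c i.
Proof.
move=> cdec i1; elim: j => [|j IH]; first by rewrite leqn0 => /eqP ->.
rewrite leq_eqVlt => /predU1P[->//|ij] jr.
by apply: le_trans (cdec j _) (IH ij (ltnW jr)); rewrite (leq_trans i1 ij).
Qed.

Definition diff_span (k : nat) (Z : {set 'rV[bool]_k * 'rV[bool]_k}) :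
  {vspace 'rV[rat]_k} := <<map (@cube_diff k) (enum Z)>>%VS.

(** The smallest subspace inducing on the cube the same cosets as U. *)
Definition diff_core (k : nat) (U : {vspace 'rV[rat]_k}) : {vspace 'rV[rat]_k} :=
  diff_span [set p | cube_diff p \in U].

Lemma diff_core_sub k (U : {vspace 'rV[rat]_k}) : (diff_core U <= U)%VS.
Proof. by apply/span_subvP => _ /mapP[p + ->]; rewrite mem_enum inE. Qed.

Lemma mem_diff_core k (U : {vspace 'rV[rat]_k}) p :
  (cube_diff p \in diff_core U) = (cube_diff p \in U).
Proof.
apply/idP/idP => [|pU]; first exact: (subvP (diff_core_sub U)).
by apply: memv_span; apply: map_f; rewrite mem_enum inE.
Qed.

Lemma diff_core_mono k (U W : {vspace 'rV[rat]_k}) :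
  (U <= W)%VS -> (diff_core U <= diff_core W)%VS.
Proof.
move=> /subvP UW; apply/span_subvP => _ /mapP[p + ->].
by rewrite mem_enum inE mem_diff_core => /UW.
Qed.

Lemma diff_core_line1 k : diff_core (line1 k) = line1 k.
Proof.
apply: subv_anti; rewrite diff_core_sub /= -memvE.
have -> : const_mx 1 = cube_diff (const_mx true, const_mx false) :> 'rV[rat]_k.
  by apply/rowP => i; rewrite !mxE subr0.
rewrite mem_diff_core.
have <- : const_mx 1 = cube_diff (const_mx true, const_mx false) :> 'rV[rat]_k.
  by apply/rowP => i; rewrite !mxE subr0.
exact: memv_line.
Qed.

Lemma entropy_diff_core (R : realType) k (mu : 'rV[bool]_k -> R) U :
  entropy mu (diff_core U) = entropy mu U.
Proof.
congr (- _); apply: eq_bigr => w _; congr (_ * ln _); apply: eq_bigl => w'.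
exact: (mem_diff_core U (w', w)).
Qed.

Section Flags.
Variables (R : realType) (k r : nat) (c : nat -> R).
Hypothesis cdec : forall j, (1 <= j <= r)%N -> c j.+1 <= c j.
Hypothesis cge0 : 0 <= c r.+1.

(** Summation by parts: the sum is at least c_r x_r, because the x_j are
    nonnegative and the c_j decrease. *)
Lemma abel_sum_ge0 (x : nat -> R) :
  (forall j, 0 <= x j) -> x 0%N = 0 ->
  0 <= \sum_(1 <= j < r.+1) c j * (x j - x j.-1).
Proof.
move=> x0 x00.
have key n : (n <= r)%N -> c n * x n <= \sum_(1 <= j < n.+1) c j * (x j - x j.-1).
  elim: n => [|n IH] nr; first by rewrite big_geq // x00 mulr0.
  rewrite big_nat_recr //= mulrBr addrCA lerDl subr_ge0.
  apply: (le_trans _ (IH (ltnW nr))).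
  case: n {IH} nr => [|n] nr; first by rewrite x00 !mulr0.
  by apply: ler_wpM2r => //; apply: cdec; apply: ltnW.
apply: (le_trans _ (key r (leqnn r))).
case: (posnP r) => [->|r0]; first by rewrite x00 mulr0.
by rewrite mulr_ge0 // (le_trans cge0) // cdec // r0 leqnn.
Qed.

(** [abel_sum_ge0] is applied to the drops in dimension. *)
Lemma flag_e_diff_core (V' : nat -> {vspace 'rV[rat]_k}) mu :
  V' 0%N = line1 k ->
  flag_e r (fun j => diff_core (V' j)) c mu <= flag_e r V' c mu.
Proof.
move=> V0; rewrite /flag_e; apply: lerD.
  by apply: ler_sum => j _; rewrite entropy_diff_core.
rewrite -subr_ge0 -sumrB.
pose x j : R := (\dim (V' j))%:R - (\dim (diff_core (V' j)))%:R.
rewrite (eq_bigr (fun j => c j * (x j - x j.-1))) => [|j _]; last by rewrite /x; ring.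
apply: abel_sum_ge0 => [j|]; last by rewrite /x V0 diff_core_line1 subrr.
by rewrite subr_ge0 ler_nat dimvS // diff_core_sub.
Qed.

(** The flags spanned by sets of differences of cube points are parametrised by
    a finite type, so one of them minimises e among those that are subflags; by
    [flag_e_diff_core] it minimises e among all subflags. *)
Lemma flag_min_attained (V : nat -> {vspace 'rV[rat]_k}) mu :
  V 0%N = line1 k -> (forall j, (j < r)%N -> (V j <= V j.+1)%VS) ->
  exists V', [/\ subflag r V' V,
    forall j, exists S, V' j = <<map (@cube_diff k) S>>%VS
    & is_min (subflag_values r V c mu) (flag_e r V' c mu)].
Proof.
move=> V0 Vmon.
pose F (t : {ffun 'I_r.+1 -> {set 'rV[bool]_k * 'rV[bool]_k}}) j :=
  diff_span (t (inord j)).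
pose core V' : {ffun 'I_r.+1 -> {set 'rV[bool]_k * 'rV[bool]_k}} :=
  [ffun j : 'I_r.+1 => [set p | cube_diff p \in (V' (val j) : {vspace 'rV[rat]_k})]].
have FE V' j : (j <= r)%N -> F (core V') j = diff_core (V' j).
  by move=> jr; rewrite /F /core ffunE /= inordK.
have Fsub V' : subflag r V' V -> subflag r (F (core V')) V.
  case=> V'0 V'mon V'V; split.
  - by rewrite FE // V'0 diff_core_line1.
  - by move=> j jr; rewrite !FE ?(ltnW jr) // diff_core_mono ?V'mon.
  - by move=> j jr; rewrite FE // (subv_trans (diff_core_sub _)) ?V'V.
have Fle V' : subflag r V' V -> flag_e r (F (core V')) c mu <= flag_e r V' c mu.
  case=> V'0 _ _; apply: le_trans (flag_e_diff_core mu V'0).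
  rewrite le_eqVlt; apply/orP; left; apply/eqP; rewrite /flag_e.
  have lt j : (1 <= j < r.+1)%N -> (j <= r)%N /\ (j.-1 <= r)%N.
    by case/andP => _; rewrite ltnS => jr; split=> //; rewrite (leq_trans (leq_pred j)).
  congr (_ + _); apply: eq_big_nat => j /lt [jr jr1]; rewrite !FE //.
pose P t := `[< subflag r (F t) V >].
have P0 : P (core V) by apply/asboolP; apply: Fsub; split.
case: (@arg_minP _ _ _ (core V) P (fun t => flag_e r (F t) c mu) P0) => t /asboolP Pt tmin.
exists (F t); split => //.
- by move=> j; exists (enum (t (inord j))).
- split; first by exists (F t).
  move=> _ [V' V'sub ->]; apply: le_trans (Fle _ V'sub).
  by apply: tmin; apply/asboolP; apply: Fsub.
Qed.
End Flags.

(** * Counting by keys *)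

Lemma card_le_image (U : choiceType) (T : finType) (S : set U) (A : {set T})
    (h : T -> U) :
  (forall s, S s -> exists2 t, t \in A & s = h t) ->
  finite_set S /\ (#|` fset_set S| <= #|A|)%N.
Proof.
move=> hS; pose I := [fset h t | t in A]%fset.
have SI : (S `<=` [set` I])%classic.
  by move=> s /hS [t tA ->] /=; apply: in_imfset.
have fS : finite_set S by apply: sub_finite_set SI _; apply: finite_fset.
split=> //; apply: (@leq_trans #|` I|).
  apply: fsubset_leq_card; apply/fsubsetP => s.
  by rewrite in_fset_set // inE => /SI.
by apply: leq_trans (leq_imfset_card _ _ _) _; rewrite cardE.
Qed.

Lemma absz_shiftK (a : int) (n : nat) :
  (`|a| <= n)%N -> (absz (a + n%:Z))%:Z - n%:Z = a.
Proof. by lia. Qed.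

(** Elements of S are identified by a key made of a point of A and an integer
    point of a box; an interval [-X, X] has 2 X + 1 integer points. *)
Lemma card_by_keys (U : choiceType) (T : finType) (S : set U) (A : {set T})
    (k : nat) (X : 'I_k -> nat) (rel : U -> T -> {ffun 'I_k -> int} -> Prop) :
  (forall s, S s -> exists t (a : {ffun 'I_k -> int}),
     [/\ t \in A, forall i, (`|a i| <= X i)%N & rel s t a]) ->
  (forall s s' t a, rel s t a -> rel s' t a -> s = s') ->
  finite_set S /\ (#|` fset_set S| <= #|A| * \prod_i (2 * X i + 1))%N.
Proof.
move=> hS hrel.
pose N := (\sum_i 2 * X i)%N.
have XN i : (2 * X i <= N)%N by rewrite /N (bigD1 i) //= leq_addr.
pose Bx : {set {ffun 'I_k -> 'I_N.+1}} :=
  [set e in family (fun i => [pred x : 'I_N.+1 | (x < 2 * X i + 1)%N])].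
pose dec (e : {ffun 'I_k -> 'I_N.+1}) : {ffun 'I_k -> int} :=
  [ffun i => (e i : nat)%:Z - (X i)%:Z].
have cBx : #|Bx| = (\prod_i (2 * X i + 1))%N.
  rewrite cardsE card_family foldrE big_image /=; apply: eq_bigr => i _.
  rewrite -sum1_card (big_ord_narrow (_ : 2 * X i + 1 <= N.+1)%N) /=; last first.
    by rewrite sum1_card card_ord.
  by rewrite addn1 ltnS.
rewrite -cBx -cardsX.
have [->|/set0P[s0 _]] := eqVneq S set0.
  by split=> //; rewrite fset_set0 cardfs0.
apply: (@card_le_image _ _ _ _ (fun y =>
  xget s0 [set s | S s /\ rel s y.1 (dec y.2)]%classic)).
move=> s Ss; have [t [a [tA aX ra]]] := hS s Ss.
pose e : {ffun 'I_k -> 'I_N.+1} := [ffun i => inord (absz (a i + (X i)%:Z))].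
have eE i : nat_of_ord (e i) = absz (a i + (X i)%:Z).
  rewrite ffunE inordK // ltnS; apply: leq_trans (XN i).
  by move: (aX i); lia.
have de : dec e = a.
  by apply/ffunP => i; rewrite /dec ffunE eE absz_shiftK.
exists (t, e).
  rewrite inE /= tA inE /=; apply/familyP => i; rewrite inE eE.
  by move: (aX i); lia.
case: xgetP => /= [_ -> [_]|/(_ s)]; last by rewrite /= de; case.
by rewrite de; apply: hrel.
Qed.

(** Summing over every possible basis makes the bound depend only on k. *)
Definition coord_bound (k : nat) : nat :=
  (1 + \sum_(g : {ffun 'I_k -> 'rV[bool]_k * 'rV[bool]_k})
     \sum_i \sum_l `|(\adj (diff_mx g)) l i|)%N.

Lemma coord_le k (g : {ffun 'I_k -> 'rV[bool]_k * 'rV[bool]_k}) w w' i :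
  (`|((cube_int w - cube_int w') *m \adj (diff_mx g)) 0%R i| <= coord_bound k)%N.
Proof.
rewrite /coord_bound (bigD1 g) //= (bigD1 i) //=.
apply: (@leq_trans (\sum_l `|(\adj (diff_mx g)) l i|)%N); last by rewrite -addnA addnCA leq_addr.
rewrite mxE; move: (\adj _) => M; elim/big_ind2: _ => // [x a y b xa yb|l _].
  by apply: leq_trans (leq_add xa yb); lia.
by rewrite !mxE; case: (w _ l); case: (w' _ l) => /=; lia.
Qed.

(** * Counting the classes of typical colourings *)

Lemma sum_ltn_ord (R : realType) (k d : nat) :
  (d <= k)%N -> \sum_(i < k) ((i < d)%N%:R : R) = d%:R.
Proof.
move=> dk; rewrite -natr_sum; congr _%:R.
rewrite -big_mkcond /= (big_ord_narrow dk) /=.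
by rewrite sum1_card card_ord.
Qed.

Lemma prod_powR (R : realType) (I : finType) (D : R) (s : I -> R) :
  0 < D -> \prod_i (D `^ s i) = D `^ (\sum_i s i).
Proof.
move=> D0; apply: esym; elim/big_ind2: _ => [|x a y b <- <-|//].
  by rewrite powRr0.
by rewrite powRD // lt0r_neq0 ?implybT.
Qed.

Lemma eq_vclass k (W : {vspace 'rV[rat]_k}) v v' :
  v - v' \in W -> vclass W v = vclass W v'.
Proof.
move=> vv'; apply/seteqP; split => y /=; rewrite /vclass /= => yW.
  by rewrite -(subrK v y) -addrA rpredD.
by rewrite -(rpredDr _ vv') addrA subrK.
Qed.

Section ClassCount.
Variables (R : realType) (k r : nat) (T : finType) (lvl : T -> 'I_r.+1).
Variables (U W : nat -> {vspace 'rV[rat]_k}) (mu : nat -> 'rV[bool]_k -> R).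
Variables (c : nat -> R) (D : R) (x : T -> int).
Variable g : {ffun 'I_k -> 'rV[bool]_k * 'rV[bool]_k}.
Hypothesis mu_prob : forall j, (1 <= j <= r)%N -> is_prob_on (U j) (mu j).
Hypothesis W0 : W 0%N = line1 k.
Hypothesis gW : forall j v, (j <= r)%N -> (map_mx intr v \in W j) =
  [forall i : 'I_k, (\dim (W j) <= i)%N ==> ((v *m \adj (diff_mx g)) 0 i == 0)].
Hypothesis cdec : forall j, (1 <= j <= r)%N -> c j.+1 <= c j.
Hypothesis cge0 : 0 <= c r.+1.
Hypothesis D1 : 1 <= D.
Hypothesis x0 : forall b, 0 <= x b.
Hypothesis xD : forall b, (0 < lvl b)%N -> (x b)%:~R <= D `^ c (lvl b).

Definition weighted_sum (om : T -> 'rV[bool]_k) : 'rV[rat]_k :=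
  \sum_b (x b)%:~R *: cube_pt (om b).

Definition typical_classes : set (set 'rV[rat]_k) :=
  [set vclass (line1 k) (weighted_sum om) | om in typical lvl W mu]%classic.

Definition dim_step (i j : nat) : bool :=
  (\dim (W j.-1) <= i < \dim (W j))%N.

(** This is c_j if the i-th basis vector enters the flag at step j with
    1 <= j <= r, and 0 otherwise; the sum avoids choosing j. *)
Definition coord_exp (i : nat) : R :=
  \sum_(1 <= j < r.+1) c j * (dim_step i j)%:R.

Lemma c_ge0 j : (1 <= j <= r.+1)%N -> 0 <= c j.
Proof. by case/andP=> j1 jr; apply: le_trans cge0 (antitone_coeffs cdec j1 jr _). Qed.

Lemma coord_exp_ge0 i : 0 <= coord_exp i.
Proof.
rewrite /coord_exp big_nat; apply: sumr_ge0 => j /andP[j1 jr].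
by rewrite mulr_ge0 // c_ge0 // j1 ltnW.
Qed.

Lemma coord_exp_ge i l : (\dim (W 0%N) <= i)%N -> (i < \dim (W l))%N ->
  (l <= r)%N -> c l <= coord_exp i.
Proof.
move=> d0 dl lr.
have ex : exists j, (i < \dim (W j))%N by exists l.
case: (ex_minnP ex) => j ij jmin.
have j1 : (0 < j)%N by case: j ij {jmin} => //; rewrite ltnNge d0.
have jl : (j <= l)%N by apply: jmin.
have jr := leq_trans jl lr.
apply: (@le_trans _ _ (c j)); first exact: antitone_coeffs cdec j1 jl (leqW lr).
have step : dim_step i j.
  rewrite /dim_step ij andbT leqNgt; apply/negP => /jmin.
  by rewrite leqNgt ltn_predL j1.
rewrite /coord_exp (bigD1_seq j) /= ?mem_index_iota ?iota_uniq ?j1 //; last first.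
rewrite step mulr1 lerDl big_seq_cond; apply: sumr_ge0 => j'.
rewrite mem_index_iota => /andP[/andP[j'1 j'r] _].
by rewrite mulr_ge0 // c_ge0 // j'1 ltnW.
Qed.

Lemma sum_coord_exp :
  (forall j, (j < r)%N -> (W j <= W j.+1)%VS) ->
  \sum_(i < k) coord_exp i =
  \sum_(1 <= j < r.+1) c j * ((\dim (W j))%:R - (\dim (W j.-1))%:R).
Proof.
move=> Wmon; rewrite exchange_big /=; apply: eq_big_nat => -[//|j] /andP[_ jr].
rewrite -mulr_sumr; congr (_ * _) => /=.
have dk l := dimv_row_le (W l).
rewrite -(sum_ltn_ord R (dk j.+1)) -(sum_ltn_ord R (dk j)) -sumrB.
apply: eq_bigr => i _; rewrite /dim_step /=.
have := dimvS (Wmon j jr).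
case: (ltnP i (\dim (W j))) => [ij|_] dd /=; last by rewrite subr0.
by rewrite (leq_trans ij dd) subrr.
Qed.

Definition box_size (i : nat) : nat :=
  Num.truncn ((coord_bound k * #|T|)%:R * D `^ coord_exp i).

Definition shift_sum (om f : T -> 'rV[bool]_k) : 'rV[int]_k :=
  \sum_b x b *: (cube_int (om b) - cube_int (f b)).

(** The vector om(b) - f(b) lies in the member of the flag at the level of b, so
    b contributes to the i-th coordinate only if the i-th basis vector has
    entered the flag by then; in that case x(b) <= D ^ coord_exp i. *)
Lemma coord_le_box om (f : T -> 'rV[bool]_k) (i : 'I_k) :
  (forall b, f b = coset_rep (W (lvl b)) (om b)) -> (\dim (W 0%N) <= i)%N ->
  (`|(shift_sum om f *m \adj (diff_mx g)) 0%R i| <= box_size i)%N.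
Proof.
move=> fE di; rewrite /box_size truncn_ge_nat; last first.
  by rewrite mulr_ge0 ?powR_ge0.
rewrite natr_absz intr_norm mulmx_suml summxE rmorph_sum /=.
apply: le_trans (ler_norm_sum _ _ _) _.
rewrite natrM mulrAC mulr_natr -sumr_const; apply: ler_sum => b _.
set y := cube_int _ - _.
have lr : (lvl b <= r)%N by rewrite -ltnS ltn_ord.
have [lb|bl] := leqP (\dim (W (lvl b))) i.
  have : map_mx intr y \in W (lvl b).
    rewrite /y map_mxB /= !map_cube_int fE -opprB rpredN.
    exact: coset_rep_diff.
  rewrite gW // => /forallP/(_ i); rewrite lb /= => /eqP y0.
  by rewrite -scalemxAl mxE y0 mulr0 rmorph0 normr0 mulr_ge0 ?powR_ge0.
have lvl_gt0 : (0 < lvl b)%N.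
  by rewrite lt0n; apply/eqP => l0; move: bl; rewrite l0 ltnNge di.
rewrite -scalemxAl mxE rmorphM normrM mulrC /=.
apply: ler_pM => //.
  rewrite -intr_norm -natr_absz /=.
  by rewrite ler_nat coord_le.
rewrite ger0_norm ?ler0z //; apply: le_trans (xD lvl_gt0) _.
by rewrite ler_powR // coord_exp_ge.
Qed.

(** The key of a class is the reduction f of a colouring representing it,
    together with the coordinates of [shift_sum] outside W_0, the other
    coordinates being set to 0.  Two colourings with equal keys have weighted
    sums that differ by an element of W_0. *)
Lemma card_typical_classes :
  finite_set typical_classes /\
  #|` fset_set typical_classes|%:R <=
    expR (\sum_(1 <= j < r.+1)
      #|[set b | lvl b == j :> nat]|%:R * entropy (mu j) (W j)) *
    \prod_(i < k) (2 * box_size i + 1)%:R.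
Proof.
pose A : {set {ffun T -> 'rV[bool]_k}} := [set f : {ffun T -> 'rV[bool]_k} |
  `[< exists2 om, typical lvl W mu om &
      forall b, f b = coset_rep (W (lvl b)) (om b) >]].
pose rel (s : set 'rV[rat]_k) (f : {ffun T -> 'rV[bool]_k}) (a : {ffun 'I_k -> int}) :=
  exists om, s = vclass (line1 k) (weighted_sum om) /\
    forall i, a i = if (\dim (W 0%N) <= i)%N
                    then (shift_sum om f *m \adj (diff_mx g)) 0 i else 0.
have [s sS|s s' f a|fin le] :=
  @card_by_keys _ _ typical_classes A k (fun i => box_size i) rel.
- case: sS => om om_typ <-.
  exists [ffun b => coset_rep (W (lvl b)) (om b)].
  exists [ffun i => if (\dim (W 0%N) <= (i : 'I_k))%N then
    (shift_sum om [ffun b => coset_rep (W (lvl b)) (om b)] *m \adj (diff_mx g)) 0 i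
    else 0]; split.
  + by rewrite inE; apply/asboolP; exists om => // b; rewrite ffunE.
  + move=> i; rewrite ffunE; case: ifP => // di.
    by apply: coord_le_box => // b; rewrite ffunE.
  + by exists om; split => // i; rewrite ffunE.
- case=> om [-> aE] [om' [-> aE']]; apply: eq_vclass.
  have -> : weighted_sum om - weighted_sum om' =
      map_mx intr (shift_sum om f - shift_sum om' f).
    rewrite -!sumrB map_mx_sum; apply: eq_bigr => b _.
    rewrite map_mxB !map_mxZ !map_mxB !map_cube_int -!scalerBr.
    by rewrite opprB addrA subrK.
  rewrite -W0 gW //; apply/forallP => i; apply/implyP => di.
  have := aE i; rewrite aE' di => e.
  by rewrite mulmxBl mxE [X in _ + X]mxE -e subrr.
split => //; rewrite -(ler_nat R) in le; apply: le_trans le _.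
rewrite natrM natr_prod ler_pM ?ler0n //; last first.
  by apply: (card_typical_reductions mu_prob) => f; rewrite inE => /asboolP.
exact: prodr_ge0.
Qed.
End ClassCount.

(** * From partitions of B to colourings *)

Lemma card_fset_cond (B : {fset int}) (p : pred int) :
  #|` [fset n in B | p n]%fset| = #|[set b : B | p (val b)]|.
Proof.
rewrite card_fset_sum1 -big_fset_condE big_seq_fsetE /= sum1_card.
by apply: eq_card => b; rewrite inE.
Qed.

Lemma interval_level_exists (R : realType) (t : nat -> R) (x : R) n :
  t n.+1 < x ->
  exists2 j, (j <= n)%N & t j.+1 < x /\ ((0 < j)%N -> x <= t j).
Proof.
elim: n => [|n IH] tx; first by exists 0%N.
have [xt|] := leP x (t n.+1); first by exists n.+1.
by case/IH => j jn tj; exists j => //; apply: leqW.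
Qed.

Section Bridge.
Variables (R : realType) (k r : nat) (V W : nat -> {vspace 'rV[rat]_k}).
Variables (c : nat -> R) (mu : nat -> 'rV[bool]_k -> R) (D : R) (B : {fset int}).
Hypothesis cdec : forall j, (1 <= j <= r)%N -> c j.+1 <= c j.
Hypothesis D1 : 1 <= D.
Hypothesis BD : forall b, b \in B -> D `^ c r.+1 < b%:~R <= D.

Lemma levels_exist :
  exists lvl : B -> 'I_r.+1, forall b,
    D `^ c (lvl b).+1 < (val b)%:~R /\
    ((0 < lvl b)%N -> (val b)%:~R <= D `^ c (lvl b)).
Proof.
suff /choice[lvl lvlP] : forall b : B, exists j : 'I_r.+1,
    D `^ c j.+1 < (val b)%:~R /\ ((0 < j)%N -> (val b)%:~R <= D `^ c j).
  by exists lvl.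
move=> b; have /andP[bD _] := BD (valP b).
have [j jr h] := interval_level_exists (t := fun j => D `^ c j) bD.
by exists (Ordinal (jr : (j < r.+1)%N)).
Qed.

Variable lvl : B -> 'I_r.+1.
Hypothesis lvlP : forall b,
    D `^ c (lvl b).+1 < (val b)%:~R /\
    ((0 < lvl b)%N -> (val b)%:~R <= D `^ c (lvl b)).

(** The intervals (D^(c_(j+1)), D^(c_j)] are pairwise disjoint, so the level is
    the only j for which b lies in the interval. *)
Lemma lvl_eq b j : (1 <= j <= r)%N ->
  (lvl b == j :> nat) = (D `^ c j.+1 < (val b)%:~R <= D `^ c j).
Proof.
case/andP => j1 jr; have [lo hi] := lvlP b.
apply/eqP/andP => [lj|[jlo jhi]]; first by rewrite -lj; split=> //; apply: hi; rewrite lj.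
have lr : (lvl b <= r)%N by rewrite -ltnS ltn_ord.
case: (ltngtP (lvl b) j) => // lj; exfalso.
  have := lt_le_trans lo jhi; apply/negP; rewrite -leNgt ler_powR //.
  exact: antitone_coeffs cdec _ lj (leqW jr).
have l0 : (0 < lvl b)%N by apply: leq_ltn_trans lj.
have := lt_le_trans jlo (hi l0); apply/negP; rewrite -leNgt ler_powR //.
exact: antitone_coeffs cdec _ lj (leqW lr).
Qed.

Lemma card_between j : (1 <= j <= r)%N ->
  #|` between B (D `^ c j.+1) (D `^ c j)| = #|[set b | lvl b == j :> nat]|.
Proof.
move=> jr; rewrite /between card_fset_cond; apply: eq_card => b.
by rewrite !inE lvl_eq.
Qed.

Lemma admissible_typical P : V 0%N = W 0%N ->
  admissible r V c mu D B P ->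
  exists2 om, typical lvl W mu om &
    partition_vector P = weighted_sum (fun b : B => val b) om.
Proof.
move=> VW [[disj cover] types top].
have /choice[om omP] : forall b : B, exists w, val b \in P w.
  by move=> b; apply/cover; apply: valP.
have PE b w : (val b \in P w) = (om b == w).
  apply/idP/eqP => [bw|<-//]; apply/eqP; apply: contraTT bw => /disj.
  by move=> /fdisjointP; apply.
have PB w : P w = [fset n in B | n \in P w]%fset.
  apply/fsetP => n; rewrite !inE /=; apply/idP/andP => [nP|[]//].
  by split=> //; apply/cover; exists w.
exists om.
  split=> [b b0|j w jr].
    apply: contraT; rewrite -VW => /top/fsetP/(_ (val b)).
    rewrite !inE omP /=.
    have [lo _] := lvlP b; rewrite b0 in lo.
    by rewrite lo; have /andP[_ ->] := BD (valP b).
  rewrite -card_between // -types // /between PB.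
  rewrite (_ : [fset n in [fset n in B | n \in P w] | _ < _ <= _]%fset =
    [fset n in B | (D `^ c j.+1 < n%:~R <= D `^ c j) && (n \in P w)]%fset); last first.
    by apply/fsetP => n; rewrite !inE /= -andbA [_ && (n \in P w)]andbC.
  rewrite card_fset_cond; congr _%:R; apply: eq_card => b.
  by rewrite !inE PE lvl_eq.
rewrite /partition_vector /weighted_sum [RHS](partition_big om predT) //=.
apply: eq_bigr => w _; rewrite /fset_sum PB -big_fset_condE big_seq_fsetE /=.
rewrite rmorph_sum scaler_suml; apply: eq_big => [b|b]; first by rewrite PE.
by rewrite PE => /eqP ->.
Qed.
End Bridge.

(** * Numerical estimates *)

(** Each level contributes an error term to the count of colourings, and this
    bounds the number of levels in terms of k. *)
Lemma flag_length_le k r (V : nat -> {vspace 'rV[rat]_k}) :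
  (forall j, (j < r)%N -> (V j <= V j.+1)%VS /\ V j != V j.+1) -> (r <= k)%N.
Proof.
move=> Vlt; have step n : (n <= r)%N -> (n <= \dim (V n))%N.
  elim: n => // n IH nr; have [le ne] := Vlt n nr.
  apply: leq_ltn_trans (IH (ltnW nr)) _.
  by rewrite ltnNge; apply: contra ne => dle; rewrite eqEdim le.
exact: leq_trans (step r (leqnn r)) (dimv_row_le _).
Qed.

(** Applied with X = L^(3/4), this absorbs the factors L of the box count. *)
Lemma linear_le_expR (R : realType) (a L X : R) :
  0 <= a -> 0 <= L -> 1 <= X -> L <= X ^+ 2 -> a * L <= expR ((a + 2) * X).
Proof.
move=> a0 L0 X1 LX.
have eX : X <= expR X by apply: le_trans (expR_ge1Dx X); rewrite lerDr.
have ea : a <= expR (a * X).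
  apply: (@le_trans _ _ (a * X)); first by rewrite ler_peMr.
  by apply: le_trans (expR_ge1Dx _); rewrite lerDr.
rewrite mulrDl expRD; apply: ler_pM => //.
  by apply: le_trans LX _; rewrite expRM_natl lerXn2r ?nnegrE ?expR_ge0 ?(le_trans ler01).
Qed.

(** The constant 7 is 2 * 3 + 1: a box of half-width at most 3 K L D^s has at
    most 2 * 3 K L D^s + 1 integer points, and K L D^s is at least 1. *)
Lemma prod_box_le (R : realType) (k n K : nat) (D L : R) (s : 'I_k -> R)
    (X : 'I_k -> nat) :
  1 <= D -> 1 <= L -> (0 < K)%N -> n%:R <= 3 * L -> (forall i, 0 <= s i) ->
  (forall i, (X i)%:R <= (K * n)%:R * D `^ s i) ->
  \prod_i (2 * X i + 1)%:R <= (7 * K%:R * L) ^+ k * D `^ (\sum_i s i).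
Proof.
move=> D1 L1 K0 nL s0 XD.
rewrite -prod_powR ?(lt_le_trans ltr01) // -[k in _ ^+ k]card_ord -prodr_const.
rewrite -big_split /=; apply: ler_prod => i _; rewrite ler0n /=.
have Ds : 1 <= D `^ s i by rewrite -(powRr0 D) ler_powR.
have K1 : (1 : R) <= K%:R by rewrite ler1n.
rewrite natrD natrM.
have XL : (X i)%:R <= 3 * (K%:R * L * D `^ s i).
  apply: le_trans (XD i) _; rewrite natrM !mulrA ler_wpM2r ?powR_ge0 //.
  by have := ler_wpM2l (ler0n R K) nL; lra.
have : 1 <= K%:R * L * D `^ s i.
  by rewrite !mulr_ege1.
by rewrite -[7 * _ * _]mulrA -[7 * _ * _]mulrA; lra.
Qed.

Lemma entropy_sum_le (R : realType) (k r : nat) (c N H : nat -> R) (L X h : R) :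
  (r <= k)%N -> 0 <= X ->
  (forall j, (1 <= j <= r)%N -> N j <= (c j - c j.+1) * L + 2 * X) ->
  (forall j, (1 <= j <= r)%N -> 0 <= H j <= h) -> 0 <= h ->
  \sum_(1 <= j < r.+1) N j * H j <=
    L * \sum_(1 <= j < r.+1) (c j - c j.+1) * H j + 2 * k%:R * h * X.
Proof.
move=> rk X0 NX Hh h0.
have -> : 2 * k%:R * h * X = \sum_(1 <= j < k.+1) 2 * h * X.
  by rewrite sumr_const_nat subn1 /= -[in RHS]mulr_natr; ring.
apply: (@le_trans _ _ (L * \sum_(1 <= j < r.+1) (c j - c j.+1) * H j +
    \sum_(1 <= j < r.+1) 2 * h * X)); last first.
  rewrite lerD2l [leRHS](big_cat_nat (n := r.+1)) //= lerDl.
  by apply: sumr_ge0 => j _; rewrite !mulr_ge0.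
rewrite mulr_sumr -big_split /=; apply: ler_sum_nat => j jr.
have /andP[H0 Hh'] := Hh j jr.
have := ler_wpM2r H0 (NX j jr).
have := ler_wpM2l X0 Hh'.
nra.
Qed.

(** * The bound *)

Theorem lemma2p3 (R : realType) (k : nat) (hk : (2 <= k)%N) :
  exists Ck Dk : R, [/\ 0 < Ck, 1 < Dk &
    forall D : R, Dk <= D ->
    forall (r : nat) (V : nat -> {vspace 'rV[rat]_k}) (c : nat -> R)
      (mu : nat -> 'rV[bool]_k -> R),
    entropy_system r V c mu ->
    forall B : {fset int},
    (forall b, b \in B -> D `^ c r.+1 < b%:~R <= D) ->
    (forall alpha beta : R,
        c r.+1 <= alpha -> alpha <= beta -> beta <= 1 ->
        `| #|` between B (D `^ alpha) (D `^ beta)|%:R - (beta - alpha) * ln D |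
          <= 2 * ln D `^ (3 / 4)) ->
    finite_set (Lset r V c mu D B) /\
    exists2 m : R, is_min (subflag_values r V c mu) m &
      #|` fset_set (Lset r V c mu D B)|%:R
        <= expR (Ck * ln D `^ (3 / 4)) * D `^ m].
Proof.
pose K := coord_bound k.
have K0 : (0 < K)%N by rewrite /K /coord_bound.
pose h : R := #|{: 'rV[bool]_k}|%:R.
pose a : R := 7 * K%:R.
have h0 : 0 <= h by [].
have a0 : 0 <= a by rewrite mulr_ge0.
(* The first term comes from the box count; the second from the errors in at
   most k of the N_j, each multiplied by an entropy of at most h.  Taking
   D >= e makes ln D, and hence (ln D)^(3/4), at least 1. *)
exists (k%:R * (a + 2) + 2 * k%:R * h), (expR 1); split.
- have k0 : (0 : R) < k%:R by rewrite ltr0n (leq_trans _ hk).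
  apply: ltr_wpDr; first by rewrite !mulr_ge0.
  by rewrite mulr_gt0 // ltr_wpDl.
- by rewrite expR_gt1.
move=> D eD r V c mu [[V0 Vlt _] _ [c1 cdec cge0] mu_prob] B BD Breg.
have D0 : 0 < D by apply: lt_le_trans eD; rewrite expR_gt0.
have L1 : 1 <= ln D by rewrite -[1]expRK ler_ln ?posrE ?expR_gt0.
have D1 : 1 <= D by apply: le_trans eD; rewrite -expR0 ler_expR.
set L := ln D in L1 Breg *; set X := L `^ (3 / 4) in Breg *.
have X1 : 1 <= X.
  have q0 : 0 <= 3 / 4 :> R by lra.
  by have := ler_powR L1 q0; rewrite powRr0.
have XL : X <= L by apply: ler1_powR => //; lra.
have LX : L <= X ^+ 2.
  rewrite expr2 /X -powRD; last by rewrite lt0r_neq0 ?implybT // (lt_le_trans ltr01).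
  by rewrite -{1}[L]powRr1 ?(le_trans ler01) // ler_powR //; lra.
have L0 : 0 <= L by apply: le_trans L1.
have Vmon j : (j < r)%N -> (V j <= V j.+1)%VS by case/Vlt.
have cmono := antitone_coeffs cdec.
have c_le1 j : (1 <= j <= r.+1)%N -> c j <= 1.
  by case/andP => j1 jr; apply: le_trans c1; apply: cmono.
have [W [[W0 Wmon WV] Wgen Wmin]] := flag_min_attained cdec cge0 mu V0 Vmon.
have [g gW] := adapted_coordinates Wmon (fun j _ => Wgen j).
have [lvl lvlP] := levels_exist BD.
have [b|b lb|fin count] := @card_typical_classes R k r B lvl V W mu c D
   (fun b => val b) g mu_prob W0 gW cdec cge0 D1.
- have /andP[/ltW bD _] := BD _ (valP b).
  rewrite -(ler0z R); apply: le_trans bD; exact: powR_ge0.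
- by have [_] := lvlP b; apply.
have sub : (Lset r V c mu D B `<=`
    typical_classes lvl W mu (fun b : B => val b))%classic.
  move=> _ [P Padm <-].
  have [om om_typ ->] := admissible_typical cdec D1 BD lvlP (etrans V0 (esym W0)) Padm.
  by exists om.
have finL := sub_finite_set sub fin.
split => //; exists (flag_e r W c mu) => //.
apply: (@le_trans _ _ #|` fset_set (typical_classes lvl W mu (fun b : B => val b))|%:R).
  by rewrite ler_nat fsubset_leq_card // -fset_set_sub.
apply: le_trans count _.
have cardB : #|{: B}|%:R <= 3 * L.
  have cr1 : c r.+1 <= 1 by apply: c_le1; rewrite leqnn.
  have BE : between B (D `^ c r.+1) D = B.
    by apply/fsetP => n; rewrite !inE /=; case: (boolP (n \in B)) => // /BD ->.
  have /ler_normlW := Breg (c r.+1) 1 (lexx _) cr1 (lexx _).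
  rewrite powRr1 ?(ltW D0) // BE.
  rewrite cardfE; have : 0 <= c r.+1 * L by rewrite mulr_ge0.
  by lra.
pose s (i : 'I_k) := coord_exp r W c i.
have s0 i : 0 <= s i by apply: coord_exp_ge0.
have box (i : 'I_k) : (box_size r B W c D i)%:R <= (K * #|{: B}|)%:R * D `^ s i.
  by rewrite truncn_le mulr_ge0 ?powR_ge0.
have := prod_box_le D1 L1 K0 cardB s0 box.
rewrite sum_coord_exp //; set Sd := \sum_(1 <= j < r.+1) _ => prod_le.
apply: le_trans (ler_pM _ _ (lexx _) prod_le) _ => //.
  by apply: prodr_ge0.
rewrite /flag_e powRD; last by rewrite lt0r_neq0 ?implybT.
rewrite !mulrA ler_wpM2r ?powR_ge0 //.
have pow_le : (7 * K%:R * L) ^+ k <= expR (k%:R * ((a + 2) * X)).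
  rewrite expRM_natl lerXn2r ?nnegrE ?expR_ge0 ?mulr_ge0 //.
  exact: linear_le_expR.
apply: le_trans (ler_pM _ _ (lexx _) pow_le) _ => //; first by rewrite exprn_ge0 ?mulr_ge0.
rewrite /powR gt_eqF // -!expRD ler_expR -/L.
have NX j : (1 <= j <= r)%N ->
    #|[set b | lvl b == j :> nat]|%:R <= (c j - c j.+1) * L + 2 * X.
  move=> jr; have /andP[j1 jr'] := jr.
  rewrite -(card_between cdec D1 lvlP jr) -lerBlDl ler_normlW // Breg //.
  - exact: cmono.
  - exact: cdec.
  - by apply: c_le1; rewrite j1 ltnW.
have HX j : (1 <= j <= r)%N -> 0 <= entropy (mu j) (W j) <= h.
  by move=> jr; rewrite (entropy_ge0 _ (mu_prob j jr)) (entropy_le_card _ (mu_prob j jr)).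
have := entropy_sum_le (flag_length_le Vlt) (le_trans ler01 X1) NX HX h0.
by lra.
Qed.
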